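(* Let $P=\{1423\}$. For $n\ge2$ and integer $l$, let $c_{n,l}$ be the number of $l$-clusters relative to $P$ whose permutation has length $n$ (with $c_{n,l}=0$ for $l\le0$), and set $c_{1,l}=\delta_{0,l}$. Then $c_{2,l}=c_{3,l}=0$ for all $l$, and for all $n\ge4$ and all $l$, $$c_{n,l}=\sum_{k\ge1,\ 2k+2\le n}\binom{n-k-2}{k}\,c_{n-2k-1,\,l-k}.$$ Consequently, if $\pi_{n,k}$ is the number of permutations of length $n$ with exactly $k$ occurrences of $1423$ and $\Pi(x,t)=\sum_{n,k}\pi_{n,k}\frac{x^n}{n!}t^k$, then $$\Pi(x,t)=\Big(1-x-\sum_{n\ge2,\,l\ge1}\frac{c_{n,l}\,x^n(t-1)^l}{n!}\Big)^{-1}.$$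
   Context: A permutation of length $n$ is a sequence containing each of $1,\dots,n$ exactly once. For a sequence $s$ of distinct integers, $\mathrm{st}(s)$ is the unique permutation with the same relative order of entries. An occurrence of a pattern $\pi$ in $\sigma$ is a consecutive segment $\sigma_i\cdots\sigma_j$ with $\mathrm{st}(\sigma_i\cdots\sigma_j)=\pi$. For a set $P$ of patterns, a $q$-cluster ($q\ge1$) is a tuple $(\sigma,\pi_1,\dots,\pi_q,i_1,\dots,i_q)$ with $\sigma$ a permutation of length $n$, $\pi_k\in P$ of length $r_k$, such that $\mathrm{st}(\sigma_{i_k}\cdots\sigma_{i_k+r_k-1})=\pi_k$ for all $k$, $i_k<i_{k+1}<i_k+r_k$ for $k<q$, $i_1=1$ and $n=i_q+r_q-1$. $\delta$ is the Kronecker delta. *)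

(* Defs.v *)
From HB Require Import structures.
From mathcomp Require Import all_boot all_order all_fingroup all_algebra.
From mathcomp Require Import zify.
Set Implicit Arguments.
Unset Strict Implicit.
Unset Printing Implicit Defensive.
Import GRing.Theory.

(** Words are [seq nat]; entries and positions in words are counted from 1. *)

Definition is_perm_word (n : nat) (s : seq nat) : bool := perm_eq s (iota 1 n).

Definition word (n : nat) (s : 'S_n) : seq nat := [seq (s i).+1 | i <- enum 'I_n].

(** Each entry is replaced by its rank; [st_perm], [st_order] and [st_unique]
    show that this is the unique permutation with the same relative order. *)
Definition st (s : seq nat) : seq nat := [seq count (leq^~ x) s | x <- s].

Definition same_order (s t : seq nat) : Prop :=
  size s = size t /\
  forall i j, i < size s -> j < size s ->
    (nth 0 s i < nth 0 s j) = (nth 0 t i < nth 0 t j).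

Definition occurs_at (pi s : seq nat) (i : nat) : bool :=
  (0 < i) && (st (take (size pi) (drop i.-1 s)) == pi).

Definition nocc (pi s : seq nat) : nat := count (occurs_at pi s) (iota 1 (size s)).

(** Here [pis = (pi_1, ..., pi_q)] and [pos = (i_1, ..., i_q)], so that the
    tuple component of index [k] is [nth _ _ k.-1]. *)
Definition is_cluster (P : seq (seq nat)) (s : seq nat)
    (pis : seq (seq nat)) (pos : seq nat) : bool :=
  let q := size pis in
  let pi k := nth [::] pis k in
  let i k := nth 0 pos k in
  [&& 0 < q, size pos == q, is_perm_word (size s) s, all (mem P) pis,
      all (fun k => occurs_at (pi k) s (i k)) (iota 0 q),
      all (fun k => i k < i k.+1 < i k + size (pi k)) (iota 0 q.-1),
      i 0 == 1 &
      size s == i q.-1 + size (pi q.-1) - 1].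

(** Positions range over [0 .. n]; all positions of a cluster of length [n] lie
    in [1 .. n] as soon as the patterns in [P] are nonempty. *)
Definition num_clusters (P : seq (seq nat)) (n q : nat) : nat :=
  #|[set c : 'S_n * q.-tuple (seq_sub P) * q.-tuple 'I_n.+1 |
      is_cluster P (word c.1.1) (map val c.1.2) (map val c.2)]|.

Definition num_perms_occ (pi : seq nat) (n k : nat) : nat :=
  #|[set s : 'S_n | nocc pi (word s) == k]|.

Definition p1423 : seq nat := [:: 1; 4; 2; 3].

Definition c1423 (n : nat) (l : int) : nat :=
  if n == 1 then (l == 0%R) : nat
  else if l is Posz q.+1 then num_clusters [:: p1423] n q.+1 else 0.

(** Formal power series in [x] over [R], as coefficient sequences. *)

Section FPS.
Variable R : comUnitRingType.
Implicit Types d e : nat -> R.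
Local Open Scope ring_scope.

Definition fps1 : nat -> R := fun n => (n == 0)%N%:R.
Definition fpsX : nat -> R := fun n => (n == 1)%N%:R.
Definition fps_mul d e : nat -> R := fun n => \sum_(i < n.+1) d i * e (n - i)%N.

(** The first [n] coefficients of the inverse, from
    [d_0 e_n = - (d_n e_0 + ... + d_1 e_(n-1))]. *)
Fixpoint fps_invs d (n : nat) : seq R :=
  if n is m.+1 then
    let e := fps_invs d m in
    rcons e (if m is 0 then (d 0)^-1
             else - (d 0)^-1 * \sum_(j < m) d (m - j)%N * e`_j)
  else [::].

Definition fps_inv d : nat -> R := fun n => (fps_invs d n.+1)`_n.

Lemma size_fps_invs d n : size (fps_invs d n) = n.
Proof. by elim: n => //= n IH; rewrite size_rcons IH. Qed.

Lemma nth_fps_invs d n m : (m < n)%N -> (fps_invs d n)`_m = fps_inv d m.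
Proof.
elim: n => // n IH; rewrite ltnS leq_eqVlt => /orP[/eqP-> //|lmn].
by rewrite -IH // /= nth_rcons size_fps_invs lmn.
Qed.

Lemma fps_inv0 d : fps_inv d 0 = (d 0)^-1.
Proof. by []. Qed.

Lemma fps_invS d n :
  fps_inv d n.+1 =
  - (d 0)^-1 * \sum_(j < n.+1) d (n.+1 - j)%N * fps_inv d j.
Proof.
rewrite {1}/fps_inv -[fps_invs d n.+2]/(rcons (fps_invs d n.+1)
  (- (d 0)^-1 * \sum_(j < n.+1) d (n.+1 - j)%N * (fps_invs d n.+1)`_j)).
rewrite nth_rcons size_fps_invs ltnn eqxx.
by congr (_ * _); apply: eq_bigr => j _; rewrite nth_fps_invs.
Qed.

Lemma fps_mulC d e : fps_mul d e =1 fps_mul e d.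
Proof.
move=> n; rewrite /fps_mul (reindex_inj rev_ord_inj) /=.
by apply: eq_bigr => i _; rewrite mulrC subSS subKn // -ltnS.
Qed.

Lemma fps_mulVr d : d 0 \is a GRing.unit -> fps_mul (fps_inv d) d =1 fps1.
Proof.
move=> du [|n]; rewrite /fps_mul /fps1.
  by rewrite big_ord1 fps_inv0 subn0 mulVr.
rewrite big_ord_recr /= subnn fps_invS mulrC mulrA mulrN divrr // mulN1r.
by apply/eqP; rewrite subr_eq0; apply/eqP/eq_bigr => i _; rewrite mulrC.
Qed.

Lemma fps_inv_unique d e : d 0 \is a GRing.unit ->
  fps_mul e d =1 fps1 -> e =1 fps_inv d.
Proof.
move=> du de n; elim/ltn_ind: n => n IH.
have := de n; rewrite -(fps_mulVr du n) /fps_mul !big_ord_recr /= subnn.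
under eq_bigr => i _ do rewrite IH //.
by move/addrI/(mulIr du).
Qed.

End FPS.

(** Generating functions, as power series in [x] over [rat[t]] with [t = 'X].
    The inner sums over [k] and [l] are cut at [n], which loses no term:
    see [num_perms_occ_gt] and [c1423_gt]. *)

Definition Pi1423 : nat -> {poly rat} := fun n =>
  ((n`!%:R)^-1 *: \sum_(0 <= k < n.+1) (num_perms_occ p1423 n k)%:R *: 'X^k)%R.

Definition C1423 : nat -> {poly rat} := fun n =>
  (if (2 <= n)%N then
     (n`!%:R)^-1 *: \sum_(1 <= l < n.+1) (c1423 n l%:Z)%:R *: ('X - 1) ^+ l
   else 0)%R.

Lemma size_word n (s : 'S_n) : size (word s) = n.
Proof. by rewrite size_map size_enum_ord. Qed.

Lemma word_perm n (s : 'S_n) : is_perm_word n (word s).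
Proof.
have u : uniq (word s).
  by rewrite map_inj_uniq ?enum_uniq // => i j [] /ord_inj /perm_inj.
apply: uniq_perm => //; first exact: iota_uniq.
apply: (uniq_min_size u _ _).2; last by rewrite size_word size_iota.
by move=> x /mapP[i _ ->]; rewrite mem_iota add1n !ltnS leq0n ltn_ord.
Qed.

Lemma word_inj n : injective (@word n).
Proof.
move=> s t st_eq; apply/permP => i; apply/ord_inj/succn_inj.
have /eq_in_map := st_eq; apply; exact: mem_enum.
Qed.

Lemma size_st s : size (st s) = size s.
Proof. exact: size_map. Qed.

Lemma st_id n s : is_perm_word n s -> st s = s.
Proof.
move=> ps; rewrite /st -[RHS]map_id; apply/eq_in_map => x.
rewrite (perm_mem ps) mem_iota add1n => /andP[x0 xn].
rewrite (seq.permP ps) -size_filter.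
have -> : [seq y <- iota 1 n | y <= x] = iota 1 x.
  have -> : n = x + (n - x) by lia.
  rewrite iotaD filter_cat (_ : filter _ (iota 1 x) = iota 1 x); last first.
    by apply/all_filterP/allP => y; rewrite mem_iota; lia.
  rewrite (_ : filter _ _ = [::]) ?cats0 //.
  by apply/eqP; rewrite -[_ == _]negbK -has_filter; apply/hasPn => y; rewrite mem_iota; lia.
exact: size_iota.
Qed.

Lemma st_ltn s x y : x \in s -> y \in s ->
  (count (leq^~ x) s < count (leq^~ y) s) = (x < y).
Proof.
move=> xs ys.
have mono a b : a <= b -> count (leq^~ a) s <= count (leq^~ b) s.
  by move=> ab; apply: sub_count => z /= za; apply: leq_trans za ab.
case: (ltnP x y) => xy; last by rewrite ltnNge mono.
have -> : count (leq^~ y) s =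
   count (leq^~ x) s + count (fun z => x < z <= y) s.
  elim: {xs ys mono} s => //= z s ->; lia.
by rewrite -addn1 leq_add2l -has_count; apply/hasP; exists y; rewrite // xy leqnn.
Qed.

Lemma st_order s : same_order (st s) s.
Proof.
split; first exact: size_st.
move=> i j; rewrite size_st => li lj.
by rewrite !(nth_map 0) // st_ltn ?mem_nth.
Qed.

Lemma st_perm s : uniq s -> is_perm_word (size s) (st s).
Proof.
move=> us; have u : uniq (st s).
  rewrite map_inj_in_uniq // => x y xs ys e.
  by case: (ltngtP x y) => //; rewrite -(@st_ltn s) // e ltnn.
apply: uniq_perm => //; first exact: iota_uniq.
apply: (uniq_min_size u _ _).2; last by rewrite size_st size_iota.
move=> x /mapP[y ys ->]; rewrite mem_iota add1n ltnS count_size andbT.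
by rewrite -has_count; apply/hasP; exists y.
Qed.

Lemma st_unique n s p : is_perm_word n p -> same_order p s -> p = st s.
Proof.
move=> pp [sz ord]; rewrite -[LHS](st_id pp).
apply: (@eq_from_nth _ 0); rewrite !size_st // => i li.
rewrite !(nth_map 0) -?sz //.
rewrite -{2}(mkseq_nth 0 p) -{2}(mkseq_nth 0 s) -sz /mkseq !count_map.
apply: eq_in_count => j; rewrite mem_iota add0n /= => lj.
by rewrite leqNgt ord // -leqNgt.
Qed.

Lemma cluster_size P s pis pos : is_cluster P s pis pos ->
  size pis <= nth 0 pos (size pis).-1.
Proof.
case/and5P=> q0 _ _ _ /and4P[_ /allP mono /eqP p0 _].
suff H k : k < size pis -> k < nth 0 pos k by have := H (size pis).-1; lia.
elim: k => [|k IH] kq; first by rewrite p0.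
have /andP[lt _] : _ && _ := mono k ltac:(rewrite mem_iota; lia).
exact: leq_ltn_trans (IH (ltnW kq)) lt.
Qed.

Lemma num_clusters_gt P n q : n < q -> num_clusters P n q = 0.
Proof.
move=> nq; apply: eq_card0 => -[[s pis] pos]; rewrite inE /=.
apply/negP => /cluster_size; rewrite size_map size_tuple.
rewrite (nth_map ord0) ?size_tuple; last by case: q nq pis pos.
by move=> /(leq_trans nq) /leq_trans /(_ (leq_ord _)); rewrite ltnn.
Qed.

Lemma c1423_gt n (l : nat) : n < l -> c1423 n l%:Z = 0.
Proof.
rewrite /c1423; case: eqP => [->|_]; first by case: l.
by case: l => // l /num_clusters_gt.
Qed.

Lemma num_perms_occ_gt pi n k : n < k -> num_perms_occ pi n k = 0.
Proof.
move=> nk; apply: eq_card0 => s; rewrite inE; apply/negP => /eqP e.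
by have := count_size (occurs_at pi (word s)) (iota 1 (size (word s)));
   rewrite -/(nocc _ _) e size_iota size_word leqNgt nk.
Qed.

(* Main.v *)
Require Import Defs.
From mathcomp Require Import all_boot all_order all_fingroup all_algebra.
From mathcomp Require Import zify ring.
Set Implicit Arguments.
Unset Strict Implicit.
Unset Printing Implicit Defensive.
Import GRing.Theory.

(** Two occurrences of 1423 can only overlap in one or two letters, so a
    cluster on a word [s] is an occurrence at the start of [s] followed by a
    cluster on [drop 2 s] or on [drop 3 s], a single letter being the trivial
    cluster; in particular the first letter of a cluster is its minimum.

    For the recurrence, count the clusters of length [n] whose second entry is
    less than [j].  Deleting the first two (resp. three) letters gives
    [g n (q+1) j = sum_(1 <= v < j-1) g (n-2) q v + (j-4) c (n-3) q],
    which is solved by iterated hockey-stick sums.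

    For the generating function, with [y = t - 1], each word satisfies
    [t^nocc(s) = sum_(m >= 1) K(take m s) t^nocc(drop m s)], [K] being the
    cluster polynomial in [y].  Averaging over all permutations makes prefix
    and suffix independent and yields [Pi = 1 + (x + C) Pi]. *)

(** * Words and clusters *)

Definition starts1423 (s : seq nat) : bool :=
  [&& 3 < size s, nth 0 s 0 < nth 0 s 2, nth 0 s 2 < nth 0 s 3
    & nth 0 s 3 < nth 0 s 1].

(** Counts the ways to mark [q] occurrences of 1423 in [s] so as to form a cluster. The one-letter
    base case forces the last mark to end the word: an occurrence has at least four letters, so only
    [drop 3] can leave a single one. *)
Fixpoint clusters_on (q : nat) (s : seq nat) : nat :=
  if q is q'.+1 then
    starts1423 s * (clusters_on q' (drop 2 s) + clusters_on q' (drop 3 s))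
  else size s == 1.

Lemma starts1423E s : (st (take 4 s) == p1423) = starts1423 s.
Proof.
case: s => [|a [|b [|c [|d s]]]]; only 1-4: by apply/eqP => -[].
have -> : take 4 [:: a, b, c, d & s] = [:: a; b; c; d] by case: s.
rewrite /starts1423 /p1423 /st /=.
apply/eqP/and3P => [[]|[]]; last first.
  move=> ac cd db.
  by do 4?[congr cons]; lia.
by move=> *; split; lia.
Qed.

Lemma occurs_at1423 s i :
  occurs_at p1423 s i = (0 < i) && starts1423 (drop i.-1 s).
Proof. by rewrite /occurs_at starts1423E. Qed.

(** Occurrences at adjacent positions would compare the second and fourth entries in opposite
    ways. *)
Lemma starts1423_drop1 s : starts1423 s -> ~~ starts1423 (drop 1 s).
Proof.
case/and4P=> _ _ _ s31; apply/negP => /and4P[_ + _ _].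
by rewrite !nth_drop ltnNge; apply/negP; rewrite negbK ltnW.
Qed.

Lemma clusters_on_oversize q s : size s <= q -> clusters_on q s = 0.
Proof.
elim: q s => [|q IH] s ltqs /=; first by case: s ltqs.
have [->|s0] := eqVneq s [::]; first by [].
have s1 : 0 < size s by case: s {ltqs} s0.
by rewrite !IH ?muln0 // size_drop; lia.
Qed.

Lemma clusters_on_head q s : 0 < clusters_on q s ->
  {in behead s, forall x, nth 0 s 0 < x}.
Proof.
elim: q s => [|q IH] s /=; first by case: s => [|? [|]].
rewrite muln_gt0 lt0b addn_gt0 => /andP[]; case: s => [|a [|b [|c [|d s]]]] //.
move=> /and3P /= [ac cd db] => /orP[] /IH /= H x.
  rewrite !inE => /or3P[/eqP->|/eqP->|xs]; [lia|lia|].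
  by have := H x xs; lia.
rewrite !inE => /or4P[/eqP->|/eqP->|/eqP->|xs]; [lia|lia|lia|].
by have := H x xs; lia.
Qed.

(** Monotonicity is asked only on the letters of [s], so that the standardisation map of a word,
    strictly increasing just on its letters, qualifies along with [bump]. *)
Definition order_invariant (T : Type) (F : seq nat -> T) : Prop :=
  forall (f : nat -> nat) s, {in s &, {mono f : x y / x < y}} ->
    F (map f s) = F s.

Lemma starts1423_inv : order_invariant starts1423.
Proof.
move=> f s fm; rewrite /starts1423 size_map.
case: ltnP => //= s3; by rewrite !(nth_map 0) ?fm ?mem_nth //; apply: leq_trans s3.
Qed.

Lemma clusters_on_inv q : order_invariant (clusters_on q).
Proof.
elim: q => [|q IH] f s fm /=; first by rewrite size_map.
rewrite starts1423_inv // -!map_drop !IH // => x y xs ys;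
  by apply: fm; [apply: mem_drop xs | apply: mem_drop ys].
Qed.

Lemma nocc1423_cons x s :
  nocc p1423 (x :: s) = starts1423 (x :: s) + nocc p1423 s.
Proof.
rewrite /nocc /= occurs_at1423 drop0 /=; congr (_ + _).
rewrite -[2]/(1 + 1) iotaDl count_map; apply: eq_in_count => i.
by rewrite mem_iota /= !occurs_at1423; case: i.
Qed.

Lemma nocc1423_inv : order_invariant (nocc p1423).
Proof.
move=> f; elim=> [//|x s IH] fm.
rewrite map_cons !nocc1423_cons -map_cons starts1423_inv // IH // => a b al bl.
by apply: fm; rewrite inE ?al ?bl orbT.
Qed.

(** * Permutations built by inserting a first letter *)

Lemma bump_mono v : {mono bump v : x y / x < y}.
Proof. by move=> x y; rewrite /bump; lia. Qed.

Lemma clusters_on_bump q v s :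
  clusters_on q (map (bump v) s) = clusters_on q s.
Proof. by apply: clusters_on_inv => x y _ _; apply: bump_mono. Qed.

Lemma sum_perm_insert (n : nat) (F : seq nat -> nat) :
  \sum_(s : 'S_n.+1) F (word s) =
  \sum_(1 <= v < n.+2) \sum_(s : 'S_n) F (v :: map (bump v) (word s)).
Proof.
rewrite big_add1 big_mkord /= pair_big /=.
pose h (p : 'I_n.+1 * 'S_n) := lift_perm ord0 p.1 p.2.
have h_inj : injective h.
  move=> [v s] [v' s'] /= e.
  have ev : v = v'.
    by have := congr1 (fun u : 'S_n.+1 => u ord0) e; rewrite /h !lift_perm_id.
  subst v'; congr pair; apply/permP => i; apply: (@lift_inj _ v).
  by have := congr1 (fun u : 'S_n.+1 => u (lift ord0 i)) e; rewrite /h !lift_perm_lift.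
(* Injectivity suffices, both sides having [(n+1)!] elements. *)
have h_bij : bijective h.
  by apply: inj_card_bij => //; rewrite card_prod card_ord !card_Sn factS.
rewrite (reindex h) /=; last exact: onW_bij.
apply: eq_bigr => -[v s] _; congr F; rewrite /word enum_ordSl /= /h lift_perm_id.
congr cons; rewrite -!map_comp; apply: eq_map => i /=.
by rewrite lift_perm_lift /= /bump; lia.
Qed.

Definition cluster_sum n q := \sum_(s : 'S_n) clusters_on q (word s).

(** When the next occurrence starts two places later, its second letter is the fourth letter of the
    first occurrence and must lie below the second letter of the whole. Bounding the second entry is
    thus what lets the recursion close. *)
Definition cluster_sum_lt n q j :=
  \sum_(s : 'S_n) clusters_on q (word s) * (nth 0 (word s) 1 < j).

Lemma word_bound n (s : 'S_n) x : x \in word s -> 0 < x <= n.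
Proof. by rewrite (perm_mem (word_perm s)) mem_iota; lia. Qed.

Lemma word_nth_bound n (s : 'S_n) i : i < n -> 0 < nth 0 (word s) i <= n.
Proof. by move=> lin; apply: (word_bound (s := s)); rewrite mem_nth ?size_word. Qed.

Lemma clusters_on_head1 n (s : 'S_n) q : 0 < n ->
  0 < clusters_on q (word s) -> nth 0 (word s) 0 = 1.
Proof.
move=> n0 /clusters_on_head H.
have : 1 \in word s by rewrite (perm_mem (word_perm s)) mem_iota; lia.
have := word_nth_bound s n0.
case: (word s) H => // a t /= H a0; rewrite inE => /orP[/eqP-> //|/H].
by lia.
Qed.

(** * The recurrence for the number of clusters *)

Lemma sum_only1 n (F : nat -> nat) : 1 < n ->
  \sum_(1 <= v < n) (v == 1) * F v = F 1.
Proof.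
move=> n1; rewrite big_ltn // eqxx mul1n big_nat big1 ?addn0 // => v.
by case/andP=> v1 _; rewrite gtn_eqF.
Qed.

(** Put the two deleted letters back in front of a cluster. The rank [v2] disregards [v1], which is
    forced to be 1, so the true second entry is [v2 + 1] and the bound [j] becomes [j.-1]. *)
Lemma cluster_sum_drop2 m q j : 1 < m -> j <= m.+3 ->
  \sum_(s : 'S_m.+2) starts1423 (word s) * clusters_on q (drop 2 (word s))
       * (nth 0 (word s) 1 < j) =
  \sum_(1 <= v < j.-1) cluster_sum_lt m q v.
Proof.
move=> m1 jm.
pose G s := starts1423 s * clusters_on q (drop 2 s) * (nth 0 s 1 < j).
rewrite -[LHS]/(\sum_(s : 'S_m.+2) G (word s)) sum_perm_insert.
under eq_bigr => v1 _.
  rewrite (sum_perm_insert m (fun s => G (v1 :: map (bump v1) s))).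
  over.
rewrite big_nat.
have E v1 : 0 < v1 < m.+3 ->
  \sum_(1 <= v2 < m.+2) \sum_(s : 'S_m)
     G (v1 :: map (bump v1) (v2 :: map (bump v2) (word s))) =
  (v1 == 1) * \sum_(1 <= v2 < m.+2) (v2 < j.-1) * cluster_sum_lt m q v2.
  move=> /andP[v10 _]; rewrite big_distrr big_nat [RHS]big_nat /=.
  apply: eq_bigr => v2 /andP[v20 _]; rewrite /cluster_sum_lt !big_distrr /=.
  apply: eq_bigr => s _; rewrite /G /= drop0 !clusters_on_bump.
  case: (posnP (clusters_on q (word s))) => [->|c0]; first by rewrite !(muln0, mul0n).
  have h1 := clusters_on_head1 (ltnW m1) c0.
  have h2 : 1 < nth 0 (word s) 1.
    have := clusters_on_head c0; rewrite h1; apply.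
    have : 1 < size (word s) by rewrite size_word.
    by case: (word s) => [|? [|? ?]] //= _; rewrite inE eqxx.
  rewrite /starts1423 /= !(size_map (bump _)) size_word.
  rewrite !(nth_map 0) ?(size_map (bump _)) ?size_word //; try lia.
  rewrite h1; move: h2; set x := nth 0 _ 1; set c := clusters_on _ _; move=> h2.
  (* From [1 < x < v2] the third entry keeps relative rank 1 among the letters after [v1], which
     leaves only 1 for [v1]. *)
  suff -> : [&& 3 < m.+2, v1 < bump v1 (bump v2 1),
     bump v1 (bump v2 1) < bump v1 (bump v2 x)
   & bump v1 (bump v2 x) < bump v1 v2] = (v1 == 1) && (x < v2).
    rewrite -!mulnb; case: (eqVneq v1 1) => [->|_]; last by rewrite !mul0n.
    rewrite /bump; have -> : (1 <= v2) + v2 < j = (v2 < j.-1) by lia.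
    ring.
  by rewrite !bump_mono /bump; lia.
rewrite (eq_bigr _ E) -big_nat sum_only1 //.
rewrite [RHS](@big_nat_widen _ _ _ _ _ m.+2) ?[RHS]big_mkcond /=; last by lia.
by apply: eq_bigr => v _; case: (v < _); rewrite ?mul1n ?mul0n.
Qed.

(** Only the minimum of the remaining cluster is shared. The first and third letters are forced and
    the second is constrained only by [2 < v2 < j.-1], which gives [j - 4] choices independent of
    the rest. *)
Lemma cluster_sum_drop3 m q j : 0 < m -> j <= m.+4 ->
  \sum_(s : 'S_m.+3) starts1423 (word s) * clusters_on q (drop 3 (word s))
       * (nth 0 (word s) 1 < j) =
  (j - 4) * cluster_sum m q.
Proof.
move=> m0 jm.
pose G s := starts1423 s * clusters_on q (drop 3 s) * (nth 0 s 1 < j).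
rewrite -[LHS]/(\sum_(s : 'S_m.+3) G (word s)) sum_perm_insert.
under eq_bigr => v1 _.
  rewrite (sum_perm_insert _ (fun s => G (v1 :: map (bump v1) s))).
  under eq_bigr => v2 _.
    rewrite (sum_perm_insert _
      (fun s => G (v1 :: map (bump v1) (v2 :: map (bump v2) s)))).
    over.
  over.
rewrite /=.
have E v1 v2 v3 : 0 < v1 -> 0 < v2 -> 0 < v3 ->
  \sum_(s : 'S_m) G (v1 :: bump v1 v2 :: bump v1 (bump v2 v3) ::
     map (bump v1) (map (bump v2) (map (bump v3) (word s)))) =
  (v1 == 1) * ((v3 == 1) * (((2 < v2) && (v2 < j.-1)) * cluster_sum m q)).
  move=> v10 v20 v30; rewrite /cluster_sum !big_distrr /=.
  apply: eq_bigr => s _; rewrite /G /= drop0 !clusters_on_bump.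
  case: (posnP (clusters_on q (word s))) => [->|c0]; first by rewrite !(muln0, mul0n).
  have h1 := clusters_on_head1 m0 c0.
  rewrite /starts1423 /= !(size_map (bump _)) size_word.
  rewrite !(nth_map 0) ?(size_map (bump _)) ?size_word //; try lia.
  rewrite h1; set c := clusters_on _ _.
  suff -> : [&& 3 < m.+3, v1 < bump v1 (bump v2 v3),
     bump v1 (bump v2 v3) < bump v1 (bump v2 (bump v3 1))
   & bump v1 (bump v2 (bump v3 1)) < bump v1 v2] = [&& v1 == 1, v3 == 1 & 2 < v2].
    rewrite -!mulnb; case: (eqVneq v1 1) => [->|_]; last by rewrite !mul0n.
    rewrite /bump; have -> : (1 <= v2) + v2 < j = (v2 < j.-1) by lia.
    ring.
  by rewrite !bump_mono /bump; lia.
transitivity (\sum_(1 <= v1 < m.+4) (v1 == 1) * \sum_(1 <= v2 < m.+3)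
   \sum_(1 <= v3 < m.+2) (v3 == 1) * (((2 < v2) && (v2 < j.-1)) * cluster_sum m q)).
  rewrite big_nat [RHS]big_nat; apply: eq_bigr => v1 /andP[v10 _].
  rewrite big_distrr big_nat [RHS]big_nat; apply: eq_bigr => v2 /andP[v20 _].
  rewrite big_distrr big_nat [RHS]big_nat; apply: eq_bigr => v3 /andP[v30 _].
  exact: E.
rewrite sum_only1 //.
under eq_bigr do rewrite sum_only1 //.
rewrite -big_distrl /=; congr (_ * _).
(* The bound on [j] makes [j.-1] the smaller argument of [minn]. *)
suff -> N : \sum_(1 <= v < N.+1) ((2 < v) && (v < j.-1)) = minn N.+1 j.-1 - 3.
  by lia.
elim: N => [|N IH]; first by rewrite big_geq //; lia.
by rewrite big_nat_recr //= IH; lia.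
Qed.

Lemma cluster_sum_lt_rec n q j : 3 < n -> j <= n.+1 ->
  cluster_sum_lt n q.+1 j =
  \sum_(1 <= v < j.-1) cluster_sum_lt (n - 2) q v
    + (j - 4) * cluster_sum (n - 3) q.
Proof.
move=> n3 jn; rewrite {1}/cluster_sum_lt.
under [LHS]eq_bigr => s _ do rewrite /= mulnDr mulnDl.
rewrite big_split; congr (_ + _).
  by case: n n3 jn => [|[|n]] // n3 jn; rewrite cluster_sum_drop2 ?subSS ?subn0 //.
by case: n n3 jn => [|[|[|n]]] // n3 jn; rewrite cluster_sum_drop3 ?subSS ?subn0 //.
Qed.

Lemma cluster_sum_ltT n q : 1 < n -> cluster_sum_lt n q n.+1 = cluster_sum n q.
Proof.
move=> n1; apply: eq_bigr => s _.
have /andP[_ le_n] := word_nth_bound s n1; rewrite ltnS le_n.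
by rewrite muln1.
Qed.

Lemma cluster_sum_short n q : 1 < n < 4 -> cluster_sum n q = 0.
Proof.
move=> n14; apply: big1 => s _; case: q => [|q] /=; rewrite ?size_word; first by lia.
by rewrite /starts1423 size_word; have -> : 3 < n = false by lia.
Qed.

Lemma cluster_sum_lt0 n q j : cluster_sum n q = 0 -> cluster_sum_lt n q j = 0.
Proof.
move=> /eqP; rewrite sum_nat_eq0 => /forallP /= H; apply: big1 => s _.
by rewrite (eqP (H s)) mul0n.
Qed.

Lemma cluster_sum_q0 n : cluster_sum n 0 = (n == 1).
Proof.
rewrite /cluster_sum; under eq_bigr do rewrite /= size_word.
rewrite sum_nat_const card_Sn; case: eqP => [->|_] //=.
by rewrite muln0.
Qed.

(** Hockey-stick summation. As [0 < k], the terms where truncated subtraction gives 0 vanish. *)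
Lemma sum_bin_shift k j : 0 < k ->
  \sum_(1 <= v < j.-1) 'C(v - k - 3, k) = 'C(j - k.+1 - 3, k.+1).
Proof.
move=> k0; elim: j => [|j IH]; first by rewrite big_geq.
case: j IH => [|[|j]] IH; only 1-2: by rewrite big_geq // bin_small //; lia.
rewrite big_nat_recr //= IH.
case: (leqP (k + 3) j.+1) => jk; last by rewrite !bin_small //; lia.
have -> : j.+3 - k.+1 - 3 = (j.+1 - k - 3).+1 by lia.
by rewrite binS; congr (_ + _); congr 'C(_, _); lia.
Qed.

(** * Clusters as tuples of positions *)

Definition gap14 : rel nat := fun i j => i < j < i + 4.

Lemma is_cluster1423E n (s : 'S_n) q i (r : seq nat) : size r = q ->
  is_cluster [:: p1423] (word s) (nseq q.+1 p1423) (i :: r) =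
  [&& i == 1, occurs_at p1423 (word s) i, path gap14 i r,
      all (occurs_at p1423 (word s)) r & n == last i r + 3].
Proof.
move=> szr; rewrite /is_cluster size_nseq /= size_word szr eqxx word_perm /=.
have -> : all (mem [:: p1423]) (nseq q p1423).
  by rewrite all_nseq; apply/orP; right; exact: mem_head.
rewrite /=.
have -> : all (fun k => occurs_at (nth [::] (p1423 :: nseq q p1423) k) (word s)
   (nth 0 (i :: r) k)) (iota 1 q) = all (occurs_at p1423 (word s)) r.
  rewrite -[iota 1 q]/(iota (1 + 0) q) iotaDl all_map.
  rewrite -[in RHS](mkseq_nth 0 r) szr /mkseq [RHS]all_map.
  by apply: eq_in_all => k; rewrite mem_iota /= nth_nseq => ->.
have -> : all (fun k => nth 0 (i :: r) k < nth 0 r k <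
   nth 0 (i :: r) k + size (nth [::] (p1423 :: nseq q p1423) k)) (iota 0 q)
   = path gap14 i r.
  apply/allP/(pathP 0) => H k.
    rewrite szr => kq; have := H k; rewrite mem_iota kq => /(_ isT).
    by rewrite -[p1423 :: _]/(nseq q.+1 p1423) nth_nseq ltnS (ltnW kq).
  rewrite mem_iota /= add0n => kq; have := H k; rewrite szr => /(_ kq).
  by rewrite -[p1423 :: _]/(nseq q.+1 p1423) nth_nseq ltnS (ltnW kq).
rewrite -[p1423 :: _]/(nseq q.+1 p1423) nth_nseq ltnSn /= -szr nth_last /=.
have -> : last i r + 4 - 1 = last i r + 3 by lia.
case: (i == 1); case: (occurs_at p1423 (word s) i); case: (all _ r);
  by case: (path gap14 i r); case: (n == last i r + 3).
Qed.

Lemma sum_tuple_cons (T : finType) q (F : seq T -> nat) :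
  \sum_(t : q.+1.-tuple T) F t = \sum_(x : T) \sum_(t : q.-tuple T) F (x :: t).
Proof.
rewrite pair_big /=.
pose h (p : T * q.-tuple T) := cons_tuple p.1 p.2.
have h_bij : bijective h.
  exists (fun t : q.+1.-tuple T => (thead t, [tuple of behead t])) => [[x t]|t].
    by congr pair; apply: val_inj.
  by case/tupleP: t => x t; apply: val_inj.
by rewrite (reindex h) //; apply: onW_bij.
Qed.

Lemma sum_gap14 n i (F : nat -> nat) : i + 3 <= n ->
  \sum_(j < n.+1) (gap14 i j) * F j = F i.+1 + F i.+2 + F i.+3.
Proof.
move=> le_n; rewrite -(big_mkord predT (fun j => gap14 i j * F j)) /=.
rewrite (@big_cat_nat _ _ _ i.+1) //=; last by lia.
rewrite (@big_cat_nat _ _ _ i.+4 i.+1) /=; [|lia|lia].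
rewrite big_nat big1 => [|j ji]; last first.
  by rewrite /gap14; have -> : i < j < i + 4 = false by lia.
rewrite [X in _ + (_ + X)]big_nat [X in _ + (_ + X)]big1 => [|j ji]; last first.
  by rewrite /gap14; have -> : i < j < i + 4 = false by lia.
rewrite big_ltn; last by lia.
rewrite big_ltn; last by lia.
rewrite big_ltn; last by lia.
rewrite big_geq // /gap14.
have -> : i < i.+1 < i + 4 by lia.
have -> : i < i.+2 < i + 4 by lia.
have -> : i < i.+3 < i + 4 by lia.
by rewrite !mul1n !addn0 add0n addnA.
Qed.

(** Induction on [q], splitting off the second position: steps 2 and 3 from [i] match the two
    branches of [clusters_on], and step 1 contributes nothing. *)
Lemma clusters_on_tuples n (s : 'S_n) q i : 0 < i ->
  occurs_at p1423 (word s) i *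
  (\sum_(t : q.-tuple 'I_n.+1)
    ([&& path gap14 i (map val t), all (occurs_at p1423 (word s)) (map val t)
      & n == last i (map val t) + 3] : nat)) =
  clusters_on q.+1 (drop i.-1 (word s)).
Proof.
move=> i0; rewrite occurs_at1423 i0 /=.
elim: q i i0 => [|q IH] i i0 /=;
  case: (boolP (starts1423 _)) => //= o; rewrite ?mul1n.
  have := o; rewrite /starts1423 => /and4P[+ _ _ _].
  rewrite !size_drop !size_word => ni.
  rewrite (big_pred1 [tuple]) => [|t]; last by apply/esym/eqP/val_inj; case: t => -[].
  by rewrite /= ; lia.
have ni : i + 3 <= n.
  by have := o; rewrite /starts1423 => /and4P[+ _ _ _]; rewrite size_drop size_word; lia.
rewrite (sum_tuple_cons q (fun t => [&& path gap14 i (map val t),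
   all (occurs_at p1423 (word s)) (map val t) & n == last i (map val t) + 3] : nat)).
transitivity (\sum_(j < n.+1) gap14 i j * clusters_on q.+1 (drop j.-1 (word s))).
  apply: eq_bigr => j _ /=.
  case: (boolP (gap14 i j)) => [/andP[ij _]|_] /=; last by rewrite big1.
  have j0 : 0 < j by lia.
  rewrite mul1n -(IH j j0) big_distrr; apply: eq_bigr => t _ /=.
  rewrite occurs_at1423 j0 /=.
  by case: (starts1423 _); rewrite /= ?mul1n ?mul0n // andbF.
rewrite (sum_gap14 (fun j => clusters_on q.+1 (drop j.-1 (word s)))) //.
have -> : clusters_on q.+1 (drop i.+1.-1 (word s)) = 0.
  have := starts1423_drop1 o; rewrite drop_drop.
  have -> : 1 + i.-1 = i by lia.
  by move=> /negbTE /= ->.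
have -> : drop 2 (drop i.-1 (word s)) = drop i.+1 (word s).
  by rewrite drop_drop; congr drop; lia.
have -> : drop 3 (drop i.-1 (word s)) = drop i.+2 (word s).
  by rewrite drop_drop; congr drop; lia.
by rewrite add0n.
Qed.

Lemma num_clusters1423 n q :
  num_clusters [:: p1423] n q.+1 = cluster_sum n q.+1.
Proof.
rewrite /num_clusters -sum1_card.
under eq_bigl do rewrite inE.
rewrite big_mkcond /=.
(* There is only one tuple of patterns, so only permutation and positions remain to be summed
   over. *)
have c1 : #|{: q.+1.-tuple (seq_sub [:: p1423])}| = 1.
  by rewrite card_tuple card_seq_sub // exp1n.
have /fintype1P[t0 allt0] : #|{: q.+1.-tuple (seq_sub [:: p1423])}| == 1 by rewrite c1.
have t0E : map val t0 = nseq q.+1 p1423.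
  apply: (@eq_from_nth _ [::]); rewrite ?size_map ?size_nseq ?size_tuple // => k kq.
  rewrite nth_nseq kq; have : nth [::] (map val t0) k \in map val t0.
    by rewrite mem_nth ?size_map ?size_tuple.
  by case/mapP => x _ ->; have := valP x; rewrite inE => /eqP.
transitivity (\sum_(s : 'S_n) \sum_(t : q.+1.-tuple 'I_n.+1)
   (is_cluster [:: p1423] (word s) (nseq q.+1 p1423) (map val t) : nat)).
  rewrite pair_big /= (reindex (fun p : 'S_n * q.+1.-tuple 'I_n.+1 => (p.1, t0, p.2))) /=.
    by apply: eq_bigr => p _; rewrite t0E; case: is_cluster.
  exists (fun c => (c.1.1, c.2)) => [[s t] //|[[s t] u] _] /=.
  by rewrite (allt0 t).
apply: eq_bigr => s _.
rewrite (sum_tuple_cons q (fun t =>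
  is_cluster [:: p1423] (word s) (nseq q.+1 p1423) (map val t) : nat)).
transitivity (\sum_(j < n.+1) (val j == 1) * clusters_on q.+1 (drop j.-1 (word s))).
  apply: eq_bigr => j _.
  under eq_bigr => t _ do rewrite map_cons is_cluster1423E ?size_map ?size_tuple //.
  case: eqP => [j1|_]; last by rewrite big1.
  rewrite -clusters_on_tuples ?j1 // mul1n big_distrr /=.
  by apply: eq_bigr => t _; rewrite mulnb.
case: n s => [|n] s.
  by rewrite big_ord1 /= mul0n; case: (word s) (size_word s).
rewrite (bigD1 (lift ord0 ord0)) //= drop0 mul1n big1 ?addn0 // => j /eqP nj.
by case: eqP => // j1; case: nj; apply: val_inj.
Qed.

(** The one-letter base case of [clusters_on] reproduces both conventions, the Kronecker delta at
    [n = 1] and the value 0 at [l = 0] for larger [n]. *)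
Lemma c1423E n q : 0 < n -> c1423 n q%:Z = cluster_sum n q.
Proof.
move=> n0; rewrite /c1423; case: eqP => [->|/eqP n1].
  case: q => [|q]; first by rewrite cluster_sum_q0.
  by apply/esym/big1 => s _; rewrite clusters_on_oversize // size_word.
case: q => [|q]; first by rewrite cluster_sum_q0 (negbTE n1).
by rewrite num_clusters1423.
Qed.

(** * Closed form of the refined counts and the recurrence *)

Lemma c1423_neg n (l : int) : (l < 0)%R -> c1423 n l = 0.
Proof. by case: l => // l _; rewrite /c1423; case: (n == 1). Qed.

(** The index [k] counts the marks up to the first shift by three: [k - 1] shifts by two and one by
    three remove [2k + 1] letters. One step of the recursion yields the term [k = 1], and the
    hockey-stick sum turns the term [k] for [n - 2] into the term [k + 1]. *)
Lemma cluster_sum_lt_closed n q j : 1 < n -> j <= n.+1 ->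
  cluster_sum_lt n q j =
  \sum_(1 <= k < n./2)
    'C(j - k - 3, k) * c1423 (n - 2 * k - 1) (q%:Z - k%:Z)%R.
Proof.
elim: q n j => [|q IH] n j n1 jn.
  rewrite cluster_sum_lt0 ?cluster_sum_q0 ?gtn_eqF //.
  by rewrite big_nat big1 // => k k0; rewrite c1423_neg ?muln0 //; lia.
case: (leqP n 3) => n3.
  by rewrite cluster_sum_lt0 ?cluster_sum_short ?n1 // big_geq //; lia.
rewrite cluster_sum_lt_rec // [RHS]big_ltn; last by lia.
rewrite addnC; congr (_ + _).
  rewrite -c1423E; last by lia.
  by rewrite bin1 intS addrC addKr; congr (_ * c1423 _ _); lia.
transitivity (\sum_(1 <= v < j.-1) \sum_(1 <= k < (n - 2)./2)
    'C(v - k - 3, k) * c1423 (n - 2 - 2 * k - 1) (q%:Z - k%:Z)%R).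
  by rewrite big_nat [RHS]big_nat; apply: eq_bigr => v vj; apply: IH; lia.
rewrite exchange_big /= [RHS]big_add1.
have -> : (n./2).-1 = (n - 2)./2 by lia.
rewrite big_nat [RHS]big_nat; apply: eq_bigr => k /andP[k0 _].
rewrite -big_distrl sum_bin_shift //; congr (_ * c1423 _ _); first by lia.
by lia.
Qed.

Lemma c1423_rec (n : nat) (l : int) : 4 <= n ->
  c1423 n l =
  \sum_(1 <= k < n | 2 * k + 2 <= n)
        'C(n - k - 2, k) * c1423 (n - 2 * k - 1) (l - k%:Z)%R.
Proof.
move=> n4; case: l => [q|q]; last first.
  by rewrite c1423_neg // big_nat_cond big1 // => k k0; rewrite c1423_neg ?muln0 //; lia.
(* Taking [j = n + 1] puts no restriction on the second entry. *)
rewrite c1423E ?(ltn_trans _ n4) // -cluster_sum_ltT; last by lia.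
rewrite cluster_sum_lt_closed //; last by lia.
rewrite (@big_nat_widen _ _ _ _ _ n); last by lia.
apply: eq_big => [k|k _]; first by lia.
by congr ('C(_, _) * _); lia.
Qed.

(** * Independence of prefix and suffix *)

Lemma word_surj n s : is_perm_word n s -> exists p : 'S_n, word p = s.
Proof.
move=> ps; have szs : size s = n by rewrite (perm_size ps) size_iota.
have us : uniq s by rewrite (perm_uniq ps) iota_uniq.
have bnd i : i < n -> 0 < nth 0 s i <= n.
  move=> lin; have : nth 0 s i \in s by rewrite mem_nth ?szs.
  by rewrite (perm_mem ps) mem_iota; lia.
pose f (i : 'I_n) : 'I_n := insubd i (nth 0 s i).-1.
have fE i : val (f i) = (nth 0 s i).-1.
  by have := bnd i (ltn_ord i) => b; rewrite val_insubd ifT //; lia.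
have f_inj : injective f.
  move=> i j /(congr1 val); rewrite !fE.
  have := bnd i (ltn_ord i); have := bnd j (ltn_ord j) => bj bi e.
  have : nth 0 s i = nth 0 s j by lia.
  by move/eqP; rewrite nth_uniq ?szs // => /eqP /val_inj.
exists (perm f_inj); apply: (@eq_from_nth _ 0); rewrite size_word ?szs // => i lin.
rewrite (nth_map (Ordinal lin)) ?size_enum_ord // permE.
rewrite [X in X.+1]fE nth_enum_ord //.
by have := bnd i lin; lia.
Qed.

Lemma enum_ordD m k :
  enum 'I_(m + k) =
  [seq lshift k i | i <- enum 'I_m] ++ [seq rshift m i | i <- enum 'I_k].
Proof.
apply: (inj_map val_inj); rewrite val_enum_ord iotaD map_cat.
congr (_ ++ _); first by rewrite -val_enum_ord -[RHS]map_comp.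
by rewrite add0n -[m in iota m]addn0 iotaDl -val_enum_ord -[LHS]map_comp -[RHS]map_comp.
Qed.

Section Average.
Local Open Scope ring_scope.
Variable R : comNzRingType.
Implicit Types F G : seq nat -> R.

Definition permute_word n (u : seq nat) (g : 'S_n) : seq nat :=
  [seq nth 0%N u (g i) | i <- enum 'I_n].

(** By invariance [u] may be replaced by its standardisation, the word of some permutation [p];
    rearranging that word by [g] gives the word of [g * p], and right translation by [p] is a
    bijection. *)
Lemma sum_permute_word n u F : order_invariant F -> uniq u -> size u = n ->
  \sum_(g : 'S_n) F (permute_word u g) = \sum_(g : 'S_n) F (word g).
Proof.
move=> Finv us szu; have := st_perm us; rewrite szu => /word_surj[p pE].
rewrite [RHS](reindex_inj (mulIg p)) /=; apply: eq_bigr => g _.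
have sub x : x \in permute_word u g -> x \in u.
  by case/mapP=> i _ ->; rewrite mem_nth ?szu.
rewrite -(Finv (fun x => count (leq^~ x) u)) => [|x y /sub xu /sub yu]; last exact: st_ltn.
congr F; rewrite /permute_word /word -map_comp; apply: eq_map => i /=.
rewrite permM; have := congr1 (fun t => nth 0%N t (g i)) pE.
rewrite (nth_map (g i)) ?size_enum_ord // nth_ord_enum => ->.
by rewrite (nth_map 0%N) ?szu.
Qed.

Definition block_fun m k (g : 'S_m) (h : 'S_k) (i : 'I_(m + k)) : 'I_(m + k) :=
  match split i with inl a => lshift k (g a) | inr b => rshift m (h b) end.

Lemma block_fun_inj m k (g : 'S_m) (h : 'S_k) : injective (block_fun g h).
Proof.
apply: (can_inj (g := block_fun g^-1%g h^-1%g)) => i; rewrite /block_fun.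
case: (split_ordP i) => [a ->|b ->].
  by rewrite (unsplitK (inl _)) permK.
by rewrite (unsplitK (inr _)) permK.
Qed.

Definition block_perm m k (g : 'S_m) (h : 'S_k) := perm (@block_fun_inj m k g h).

(** In a product the left factor acts first, so multiplying by [block_perm g h] on the left
    rearranges positions inside each block. *)
Lemma word_block_perm m k (g : 'S_m) (h : 'S_k) (s : 'S_(m + k)) :
  word (block_perm g h * s)%g =
  permute_word (take m (word s)) g ++ permute_word (drop m (word s)) h.
Proof.
have wE (j : 'I_(m + k)) : nth 0%N (word s) j = (s j).+1.
  by rewrite (nth_map j) ?size_enum_ord // nth_ord_enum.
rewrite {1}/word enum_ordD map_cat.
congr (_ ++ _); rewrite -[LHS]map_comp; apply: eq_map => i /=.
  rewrite permM permE /block_fun (unsplitK (inl _)) nth_take //.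
  rewrite -[X in nth _ _ X]/(val (lshift k (g i))).
  by rewrite wE.
rewrite permM permE /block_fun (unsplitK (inr _)) nth_drop.
rewrite -[X in nth _ _ X]/(val (rshift m (h i))).
by rewrite wE.
Qed.

(* Averaging over the action of ['S_m * 'S_k] on positions, which permutes
   ['S_(m + k)] and decouples the two factors. *)
Lemma sum_perm_split m k F G : order_invariant F -> order_invariant G ->
  (m`! * k`!)%:R *
    (\sum_(s : 'S_(m + k)) F (take m (word s)) * G (drop m (word s))) =
  (m + k)`!%:R * ((\sum_(s : 'S_m) F (word s)) * (\sum_(s : 'S_k) G (word s))).
Proof.
move=> Finv Ginv.
transitivity (\sum_(g : 'S_m) \sum_(h : 'S_k) \sum_(s : 'S_(m + k))
    F (permute_word (take m (word s)) g) * G (permute_word (drop m (word s)) h)).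
  (* The factor [m! k!] becomes a sum over pairs [(g, h)], and for each pair [s] is translated by
     its block permutation. *)
  rewrite natrM -mulrA !mulr_natl -!card_Sn -!sumr_const.
  apply: eq_bigr => g _; apply: eq_bigr => h _.
  rewrite (reindex_inj (mulgI (block_perm g h))) /=.
  apply: eq_bigr => s _; rewrite word_block_perm.
  by rewrite take_size_cat ?drop_size_cat // size_map size_enum_ord.
under eq_bigr do rewrite exchange_big /=.
rewrite exchange_big /= mulr_natl -card_Sn -sumr_const; apply: eq_bigr => s _.
have uw : uniq (word s) by rewrite (perm_uniq (word_perm s)) iota_uniq.
rewrite -(@sum_permute_word _ (take m (word s))) ?take_uniq
  ?size_take_min ?size_word //; last by lia.
rewrite -(@sum_permute_word _ (drop m (word s)) G) ?drop_uniq
  ?size_drop ?size_word //; last by lia.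
by rewrite big_distrlr.
Qed.

End Average.

(** * The cluster method *)

Section ClusterMethod.
Local Open Scope ring_scope.

Let y : {poly rat} := 'X - 1.

(** The cut-off loses nothing once [N] is at least [size s], by [clusters_on_oversize]; it drops by
    one at each unfolding, which suits induction on [N]. *)
Definition cluster_poly N (s : seq nat) : {poly rat} :=
  \sum_(0 <= q < N) (clusters_on q s)%:R *: y ^+ q.

Lemma cluster_polyS N s : cluster_poly N.+1 s =
  (size s == 1%N)%:R +
  (starts1423 s)%:R * y * (cluster_poly N (drop 2 s) + cluster_poly N (drop 3 s)).
Proof.
rewrite /cluster_poly big_nat_recl //= expr0 scaler_nat; congr (_ + _).
rewrite -big_split /= big_distrr /=; apply: eq_bigr => q _.
have Z k (p : {poly rat}) : k%:R *: p = k%:R * p by rewrite scaler_nat mulr_natl.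
by rewrite !Z natrM natrD exprS -mulrDl mulrACA.
Qed.

Lemma cluster_poly_inv N : order_invariant (cluster_poly N).
Proof. by move=> f s fm; apply: eq_bigr => q _; rewrite clusters_on_inv. Qed.

Lemma starts1423_take m s : (3 < m)%N -> starts1423 (take m s) = starts1423 s.
Proof.
move=> m3; rewrite /starts1423 size_take_min !nth_take; [|lia..].
by congr (_ && _); lia.
Qed.

Lemma XnoccS x s : 'X^(nocc p1423 (x :: s)) =
  (1 + (starts1423 (x :: s))%:R * y) * 'X^(nocc p1423 s) :> {poly rat}.
Proof.
rewrite nocc1423_cons exprD; congr (_ * _); case: starts1423; rewrite /y /=.
  by rewrite expr1 mul1r addrC subrK.
by rewrite mul0r addr0.
Qed.

Lemma cluster_poly_size1 N s : size s = 1%N -> cluster_poly N.+1 s = 1.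
Proof. by move=> s1; rewrite cluster_polyS s1 /starts1423 s1 mul0r mul0r addr0. Qed.

(** Expanding each [t] as [1 + y] marks a subset of the occurrences; [m] is the length of the marked
    cluster containing the first letter, with [m = 1] if that letter is in no marked occurrence. The
    induction expands the word from its first letter. *)
Lemma Xnocc_cluster N s : (0 < size s < N)%N ->
  'X^(nocc p1423 s) = \sum_(1 <= m < (size s).+1)
     cluster_poly N (take m s) * 'X^(nocc p1423 (drop m s)).
Proof.
elim: N s => [|N IH] s /andP[s0 sN]; first by rewrite ltn0 in sN.
rewrite big_ltn // cluster_poly_size1 ?size_takel // mul1r.
have -> : 'X^(nocc p1423 s) = (1 + (starts1423 s)%:R * y) * 'X^(nocc p1423 (drop 1 s)).
  by case: s s0 {sN} => // x s _; rewrite XnoccS /= drop0.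
rewrite mulrDl mul1r; congr (_ + _).
(* Without an occurrence at the start, no prefix of two or more letters carries a cluster. *)
have [o|no] := boolP (starts1423 s); last first.
  rewrite !mul0r big_nat big1 // => m /andP[m1 ms].
  rewrite cluster_polyS size_takel // gtn_eqF // add0r.
  case: (leqP m 3) => m3; last by rewrite starts1423_take // (negbTE no) !mul0r.
  by rewrite /starts1423 size_takel // ltnNge m3 !mul0r.
have s3 : (3 < size s)%N by case/and4P: o.
have sz2 : size (drop 2 s) = (size s - 2)%N by rewrite size_drop.
have sz3 : size (drop 3 s) = (size s - 3)%N by rewrite size_drop.
have -> : 'X^(nocc p1423 (drop 1 s)) = 'X^(nocc p1423 (drop 2 s)) :> {poly rat}.
  have := starts1423_drop1 o; have -> : drop 2 s = drop 1 (drop 1 s) by rewrite drop_drop.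
  have : (0 < size (drop 1 s))%N by rewrite size_drop; lia.
  case: (drop 1 s) => // a u _ no; rewrite XnoccS (negbTE no) /= drop0.
  by rewrite mul0r addr0 mul1r.
(* Prefixes of two or three letters are too short for a cluster, so their terms vanish. *)
rewrite big_ltn; last by lia.
rewrite big_ltn; last by lia.
rewrite !cluster_polyS !size_takel; [|lia..].
rewrite /(starts1423 (take 2 s)) /(starts1423 (take 3 s)) !size_takel; [|lia..].
rewrite /= !mul0r !addr0 !mul0r !add0r.
transitivity (y * (\sum_(4 <= m < (size s).+1)
    cluster_poly N (take (m - 2) (drop 2 s)) * 'X^(nocc p1423 (drop m s)) +
   \sum_(4 <= m < (size s).+1)
    cluster_poly N (take (m - 3) (drop 3 s)) * 'X^(nocc p1423 (drop m s)))); last first.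
  rewrite -big_split /= big_distrr /= big_nat [RHS]big_nat.
  apply: eq_bigr => m /andP[m4 ms].
  rewrite cluster_polyS size_takel // gtn_eqF //; last by lia.
  rewrite starts1423_take // o /= !take_drop !subnK; [|lia..].
  by rewrite add0r mul1r -mulrDl mulrA.
rewrite mul1r; congr (_ * _).
rewrite -[4%N]/(2 + 2)%N big_addn -[(2 + 2)%N]/(1 + 3)%N big_addn.
have N0 : (0 < N)%N by lia.
have := IH (drop 3 s); rewrite sz3 => /(_ ltac:(lia)).
have -> : (size s - 3).+1 = ((size s).+1 - 3)%N by lia.
have -> : \sum_(1 <= m < (size s).+1 - 3)
    cluster_poly N (take m (drop 3 s)) * 'X^(nocc p1423 (drop m (drop 3 s))) =
  \sum_(1 <= i < (size s).+1 - 3)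
    cluster_poly N (take (i + 3 - 3) (drop 3 s)) * 'X^(nocc p1423 (drop (i + 3) s)).
  by apply: eq_bigr => m _; rewrite addnK drop_drop.
move=> <-.
have := IH (drop 2 s); rewrite sz2 => /(_ ltac:(lia)) ->.
(* In the expansion of [drop 2 s], the term [m = 1] is the power for [drop 3 s], whose own expansion
   is the sum for shift three; the other terms form the sum for shift two. *)
rewrite [LHS]big_ltn; last by lia.
have -> : cluster_poly N (take 1 (drop 2 s)) = 1.
  by case: (N) N0 => // N' _; rewrite cluster_poly_size1 // size_takel // sz2; lia.
rewrite mul1r drop_drop addrC; congr (_ + _).
have -> : (size s - 2).+1 = ((size s).+1 - 2)%N by lia.
by apply: eq_bigr => m _; rewrite addnK drop_drop.
Qed.

(** * Averages over permutations and the generating function *)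

Definition perm_avg n (F : seq nat -> {poly rat}) : {poly rat} :=
  (n`!%:R)^-1 *: \sum_(s : 'S_n) F (word s).

Lemma perm_avg_split m n F G : (m <= n)%N ->
  order_invariant F -> order_invariant G ->
  perm_avg n (fun s => F (take m s) * G (drop m s)) =
  perm_avg m F * perm_avg (n - m) G.
Proof.
move=> le_mn Finv Ginv; move: (n - m)%N (subnKC le_mn) => k <- {n le_mn}.
have := @sum_perm_split _ m k F G Finv Ginv.
rewrite /perm_avg; set A := \sum_(s : 'S_(m + k)) _; set B := \sum_s _; set C := \sum_s _.
rewrite !mulr_natl -!scaler_nat => e.
have f0 j : (j`!%:R : rat) != 0 by rewrite Num.Theory.pnatr_eq0 -lt0n fact_gt0.
have mk0 : (m`! * k`!)%:R != 0 :> rat by rewrite natrM mulf_neq0.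
rewrite -scalerAl -scalerAr scalerA -invfM -natrM.
apply: (scalerI mk0); rewrite scalerA mulrC -scalerA e !scalerA.
by rewrite mulVf ?mulfV.
Qed.

Lemma Pi1423E n : Pi1423 n = perm_avg n (fun s => 'X^(nocc p1423 s)).
Proof.
rewrite /Pi1423 /perm_avg; congr (_ *: _).
under eq_bigr => k _.
  rewrite /num_perms_occ -sum1_card natr_sum scaler_suml big_mkcond /=.
  over.
rewrite exchange_big /=; apply: eq_bigr => s _.
have le_n : (nocc p1423 (word s) <= n)%N.
  by rewrite (leq_trans (count_size _ _)) // size_iota size_word.
rewrite (bigD1_seq (nocc p1423 (word s))) ?mem_index_iota ?iota_uniq //=.
rewrite inE eqxx scale1r big1 ?addr0 // => k kn.
by rewrite inE eq_sym (negbTE kn).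
Qed.

(** The series [x] stands for the one-letter cluster, so [x + C] collects the averaged cluster
    polynomials of all lengths. *)
Lemma fpsX_C1423E m N : (0 < m < N)%N ->
  @fpsX {poly rat} m + C1423 m = perm_avg m (cluster_poly N).
Proof.
move=> /andP[m0 mN].
have sumE : \sum_(s : 'S_m) cluster_poly N (word s) =
    \sum_(0 <= q < N) (c1423 m q%:Z)%:R *: y ^+ q.
  rewrite exchange_big /=; apply: eq_bigr => q _.
  by rewrite c1423E // /cluster_sum natr_sum scaler_suml.
rewrite /perm_avg sumE /fpsX /C1423.
case: (leqP 2 m) => m2; last first.
  have -> : m = 1%N by lia.
  rewrite addr0 (_ : 1`! = 1%N) // invr1 scale1r big_ltn ?(leq_trans _ mN) //.
  rewrite big_nat big1 ?addr0 ?scale1r // => q /andP[q0 _].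
  by rewrite /c1423 /=; case: q q0 => // q _; rewrite scale0r.
rewrite gtn_eqF // add0r; congr (_ *: _).
rewrite [RHS]big_ltn ?(leq_trans _ mN) //.
have -> : c1423 m 0%:Z = 0%N by rewrite /c1423 gtn_eqF.
rewrite scale0r add0r (@big_cat_nat _ _ _ m.+1 1 N) //= [X in _ = _ + X]big_nat.
rewrite [X in _ = _ + X]big1 ?addr0 // => q /andP[mq _].
by rewrite c1423_gt ?scale0r.
Qed.

Lemma Pi1423_rec n : Pi1423 n.+1 =
  \sum_(i < n.+1) Pi1423 i * (@fpsX {poly rat} (n.+1 - i)%N + C1423 (n.+1 - i)%N).
Proof.
rewrite Pi1423E /perm_avg.
(* One cut-off, exceeding the length [n + 1], serves all prefixes at once. *)
under eq_bigr => s _ do rewrite (@Xnocc_cluster n.+2) ?size_word ?ltnS ?leqnn //.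
rewrite exchange_big /= scaler_sumr big_nat.
transitivity (\sum_(1 <= m < n.+2) Pi1423 (n.+1 - m)%N * (@fpsX {poly rat} m + C1423 m)).
  rewrite [RHS]big_nat; apply: eq_bigr => m /andP[m0 mn].
  rewrite (@fpsX_C1423E m n.+2) ?m0 // Pi1423E mulrC.
  apply: perm_avg_split => //; first exact: cluster_poly_inv.
  by move=> f s fm; rewrite nocc1423_inv.
rewrite big_add1 big_mkord (reindex_inj rev_ord_inj) /=.
apply: eq_bigr => i _; have lin := ltn_ord i.
have -> : (n.+1 - i.+1).+1 = (n.+1 - i)%N by lia.
by rewrite subKn // ltnW.
Qed.

(** The denominator has constant term 1, so uniqueness of the inverse reduces the claim to the
    convolution recurrence for [Pi1423] and its value 1 at length 0. *)
Lemma Pi1423_inv :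
  Pi1423 =1 fps_inv (@fps1 {poly rat} \- @fpsX {poly rat} \- C1423).
Proof.
have d0 : (@fps1 {poly rat} \- @fpsX {poly rat} \- C1423) 0%N = 1.
  by rewrite /fps1 /fpsX /C1423 /= !subr0.
apply: fps_inv_unique; first by rewrite d0 unitr1.
case=> [|n]; rewrite /fps_mul big_ord_recr /= subnn.
  rewrite big_ord0 add0r /fps1 /fpsX /C1423 /= !subr0 mulr1.
  rewrite Pi1423E /perm_avg fact0 invr1 scale1r.
  under eq_bigr => s _ do rewrite (size0nil (size_word s)) expr0.
  by rewrite sumr_const card_Sn fact0.
rewrite -[X in _ + _ * X]/((@fps1 {poly rat} \- @fpsX {poly rat} \- C1423) 0%N) d0 mulr1.
rewrite Pi1423_rec -big_split /= [RHS]/fps1 big1 // => i _.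
have -> : @fps1 {poly rat} (n.+1 - i) = 0 by rewrite /fps1 subn_eq0 leqNgt ltn_ord.
by rewrite sub0r -opprD mulrN addNr.
Qed.

End ClusterMethod.

Theorem theorem1423 :
  (forall l : int, c1423 2 l = 0 /\ c1423 3 l = 0) /\
  (forall (n : nat) (l : int), 4 <= n ->
     c1423 n l =
     \sum_(1 <= k < n | 2 * k + 2 <= n)
        'C(n - k - 2, k) * c1423 (n - 2 * k - 1) (l - k%:Z)%R) /\
  Pi1423 =1 fps_inv (@fps1 {poly rat} \- @fpsX {poly rat} \- C1423)%R.
Proof.
split; last by split; [exact: c1423_rec | exact: Pi1423_inv].
case=> q; last by rewrite !c1423_neg.
by rewrite !c1423E // !cluster_sum_short.
Qed.
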